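(* Let $n\ge 2$, $d\ge 1$, $\tau=1$, and let $\mu^\star_1,\mu^\star_2\stackrel{\mathrm{i.i.d.}}{\sim}\mathcal N(0,I_d)$ and $\xi_1,\dots,\xi_n\stackrel{\mathrm{i.i.d.}}{\sim}\mathcal N(0,\sigma^2 I_d)$, independent, let $z^\star_1,\dots,z^\star_n\in\{1,2\}$ be fixed labels with both classes nonempty, and $x_i=\mu^\star_{z^\star_i}+\xi_i$. Fix $q>1$ and let $\{C_1,C_2\}$ be a fixed $q$-approximately balanced partition of $[n]$, with centroids $\widehat\mu_j=|C_j|^{-1}\sum_{k\in C_j}x_k$. Fix $i\in[n]$, let $j$ be such that $i\in C_j$ and $\overline j$ the other index. Fix $\beta>1$ and suppose $$\sigma=\beta\,\frac{\sqrt n\,q+n-2}{\sqrt2\,\sqrt{\sqrt n\,q+n}}.$$ Then $$\mathbb P\bigl(\|x_i-\widehat\mu_{\overline j}\|^2-\|x_i-\widehat\mu_j\|^2<0\bigr)\le\rho_q^{d/4},$$ where $$\rho_q=\frac{\sigma^2(\sqrt n q+n-2)(\sqrt n q+n)(\sqrt n q+n+2)\bigl(\sqrt n(\sigma^2+2)(\sqrt n+q)-4\bigr)}{\bigl(n\sigma^2(\sqrt n+q)^2+(\sqrt n q+n-2)^2\bigr)^2}.$$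
   Context: A bipartition $\{C_1,C_2\}$ of $[n]=\{1,\dots,n\}$ is $q$-approximately balanced if for $k\in\{1,2\}$, $|C_k|>2$ and $\frac n2-q\sqrt{n/4}<|C_k|<\frac n2+q\sqrt{n/4}$. Randomness is only over the centers and the noise; labels and partition are deterministic. *)

(* Defs.v *)
From HB Require Import structures.
From mathcomp Require Import all_boot all_order all_algebra.
From mathcomp Require Import all_classical all_reals all_analysis.
Set Implicit Arguments. Unset Strict Implicit. Unset Printing Implicit Defensive.
Import Order.TTheory GRing.Theory Num.Theory.
Local Open Scope classical_set_scope.
Local Open Scope ring_scope.

Definition std_normal {R : realType} {dT : measure_display} {T : measurableType dT}
  (P : probability T R) (X : T -> R) : Prop :=
  forall A : set R, measurable A -> P (X @^-1` A) = normal_prob 0 1 A.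

(* Mutual independence of a finite family of real random variables:
   product rule for every choice of Borel sets (taking B i = setT
   recovers every subfamily). *)
Definition mutually_independent {R : realType} {dT : measure_display}
  {T : measurableType dT} (P : probability T R) (I : finType) (X : I -> T -> R) : Prop :=
  forall B : I -> set R, (forall i, measurable (B i)) ->
    P (\bigcap_(i in [set: I]) (X i @^-1` B i)) = (\prod_(i : I) P (X i @^-1` B i))%E.

Definition other (j : 'I_2) : 'I_2 := if j == ord0 then ord_max else ord0.

Definition cluster (n : nat) (C : 'I_n -> 'I_2) (k : 'I_2) : {set 'I_n} :=
  [set i | C i == k].

Definition approx_balanced {R : realType} (n : nat) (q : R) (C : 'I_n -> 'I_2) : Prop :=
  forall k : 'I_2,
    (2 < #|cluster C k|)%N /\
    n%:R / 2 - q * Num.sqrt (n%:R / 4) < (#|cluster C k|)%:R /\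
    (#|cluster C k|)%:R < n%:R / 2 + q * Num.sqrt (n%:R / 4).

Definition centroid {R : realType} (n d : nat) (C : 'I_n -> 'I_2)
  (x : 'I_n -> 'I_d -> R) (k : 'I_2) : 'I_d -> R :=
  fun c => (#|cluster C k|%:R)^-1 * \sum_(l in cluster C k) x l c.

Definition sqnorm {R : realType} (d : nat) (v : 'I_d -> R) : R :=
  \sum_(c < d) v c ^+ 2.

Definition rho_q {R : realType} (n : nat) (q sigma : R) : R :=
  let s := Num.sqrt (n%:R : R) in
  sigma ^+ 2 * (s * q + n%:R - 2) * (s * q + n%:R) * (s * q + n%:R + 2)
    * (s * (sigma ^+ 2 + 2) * (s + q) - 4)
  / (n%:R * sigma ^+ 2 * (s + q) ^+ 2 + (s * q + n%:R - 2) ^+ 2) ^+ 2.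

(* Main.v *)
Require Import Defs.
From HB Require Import structures.
From mathcomp Require Import all_boot all_order all_algebra.
From mathcomp Require Import all_classical all_reals all_analysis.
From mathcomp Require Import measurable_realfun ring lra.
Import Order.TTheory GRing.Theory Num.Theory.
Local Open Scope classical_set_scope.
Local Open Scope ring_scope.

(** Write U = x_i - mu_other and V = x_i - mu_j. By Chernoff,
    P(|U|^2 < |V|^2) is at most E exp(theta (|V|^2 - |U|^2) / 4) for every
    theta >= 0, and Cauchy-Schwarz separates the two exponential moments, so
    the correlation of U and V plays no role. The coordinates of V (of U) are
    i.i.d. centred Gaussian with a variance at most v (at least u), where, with
    M = (sqrt n q + n) / 2 bounding both cluster sizes,
    v = 2 (1 - 1/M)^2 + sigma^2 (1 - 1/M) and u = sigma^2 (1 + 1/M). The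
    hypothesis on sigma says v < u; theta = (u - v) / (2 u v) then gives
    (4 u v / (u + v)^2)^(d/4), and 4 u v / (u + v)^2 = rho_q. *)

(** * Independence of finite lists of random variables *)

Definition Mset (R : realType) := {A : set R | measurable A}.

Definition box {R : realType} {dT} {T : measurableType dT}
  (l : seq ({mfun T >-> R} * Mset R)) : set T :=
  \big[setI/setT]_(p <- l) (p.1 @^-1` sval p.2).

(* Independence is stated for lists so that entries can be merged
   ([indep_seq_merge]) and regrouped. *)
Definition indep_seq {R : realType} {dT} {T : measurableType dT}
  (P : probability T R) (s : seq {mfun T >-> R}) : Prop :=
  forall l : seq ({mfun T >-> R} * Mset R), unzip1 l = s ->
    P (box l) = (\prod_(p <- l) P (p.1 @^-1` sval p.2))%E.

Section independence.
Context {R : realType} {dT : measure_display} {T : measurableType dT}.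
Variable P : probability T R.
Implicit Types (X Y Z : {mfun T >-> R}) (s : seq {mfun T >-> R}).

Definition MsetT : Mset R := exist _ setT measurableT.

Lemma measurable_preimage X (A : set R) : measurable A -> measurable (X @^-1` A).
Proof. by move=> mA; rewrite -[X in measurable X]setTI; exact: measurable_funP. Qed.

Lemma measurable_box (l : seq ({mfun T >-> R} * Mset R)) : measurable (box l).
Proof.
apply: bigsetI_measurable => p _; exact: measurable_preimage (svalP p.2).
Qed.

Lemma indep_seq_behead X s : indep_seq P (X :: s) -> indep_seq P s.
Proof.
move=> Xs l ls; have := Xs ((X, MsetT) :: l).
rewrite /box /= ls !big_cons /= preimage_setT setTI probability_setT mul1e.
exact.
Qed.

Lemma indep_seq_catC s1 s2 : indep_seq P (s1 ++ s2) -> indep_seq P (s2 ++ s1).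
Proof.
move=> s12 l ls; rewrite -(cat_take_drop (size s2) l).
have := s12 (drop (size s2) l ++ take (size s2) l).
rewrite /unzip1 map_cat map_take map_drop -/(unzip1 l) ls take_size_cat//.
rewrite drop_size_cat// /box !big_cat /= => E.
by rewrite setIC E// muleC.
Qed.

(** Both sides are measures in [E] that agree on rectangles, so uniqueness of the product measure
    applies. The event [D] will carry the constraints on the remaining variables; the mass [P D] is
    scaled into the first factor, which avoids conditioning and allows [P D = 0]. *)
Lemma joint_law X Y (D : set T) : measurable D ->
    (forall A B : set R, measurable A -> measurable B ->
      P ((X @^-1` A `&` Y @^-1` B) `&` D) =
      (P (X @^-1` A) * P (Y @^-1` B) * P D)%E) ->
  forall E : set (R * R), measurable E ->
    P ((fun w => (X w, Y w)) @^-1` E `&` D) =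
    (P D * (distribution P X \x distribution P Y) E)%E.
Proof.
move=> mD XYD E mE.
pose h w := (X w, Y w).
have mh : measurable_fun setT h by exact: measurable_fun_pair.
pose m' : {measure set (R * R) -> \bar R} := pushforward (mrestr P mD) h.
have PD : 0 <= fine (P D) by exact: fine_ge0.
pose r : {nonneg R} := NngNum PD.
pose m1 : {finite_measure set R -> \bar R} := mscale r (distribution P X).
rewrite -[LHS]/(m' mh E).
rewrite -(@product_measure_unique _ _ _ _ R m1 (distribution P Y) (m' mh) _ E mE).
  rewrite /product_measure1 /= ge0_integral_mscale//=.
    by rewrite fineK// fin_num_measure.
  by apply: measurable_fun_xsection => //; rewrite inE.
move=> A B mA mB.
transitivity (P ((X @^-1` A `&` Y @^-1` B) `&` D)); first by [].
rewrite XYD// -[RHS]/((fine (P D))%:E * P (X @^-1` A) * P (Y @^-1` B))%E.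
by rewrite fineK ?fin_num_measure// -[RHS]muleA muleC.
Qed.

Lemma indep_seq_box2 X Y s l (A B : set R) : indep_seq P [:: X, Y & s] ->
  unzip1 l = s -> measurable A -> measurable B ->
  P ((X @^-1` A `&` Y @^-1` B) `&` box l) =
  (P (X @^-1` A) * P (Y @^-1` B) * P (box l))%E.
Proof.
move=> XYs ls mA mB; have := XYs [:: (X, exist _ A mA), (Y, exist _ B mB) & l].
rewrite /= ls /box !big_cons /= -/(box l) setIA => ->//.
by rewrite (indep_seq_behead _ _ (indep_seq_behead _ _ XYs))// muleA.
Qed.

Lemma joint_law_indep X Y s (E : set (R * R)) : indep_seq P [:: X, Y & s] ->
  measurable E ->
  P ((fun w => (X w, Y w)) @^-1` E) = ((distribution P X \x distribution P Y) E)%E.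
Proof.
move=> XYs mE.
have bT : unzip1 [seq (X, MsetT) | X <- s] = s.
  by rewrite /unzip1 -map_comp map_id_in.
have bTT : box [seq (X, MsetT) | X <- s] = setT.
  by rewrite /box big_map big1.
have := joint_law X Y _ (measurable_box _)
  (fun A B => indep_seq_box2 _ _ _ _ A B XYs bT) _ mE.
by rewrite bTT setIT probability_setT mul1e.
Qed.

(** The event that [h (X, Y)] lies in a Borel set is the preimage of a Borel set of the plane, so
    [joint_law] with [D] the box of the other variables factors it out. *)
Lemma indep_seq_merge X Y Z s (h : R * R -> R) : measurable_fun setT h ->
  (forall w, Z w = h (X w, Y w)) ->
  indep_seq P [:: X, Y & s] -> indep_seq P (Z :: s).
Proof.
move=> mh ZE XYs [//|[Z' A] l] /= [ZZ' ls]; rewrite {}ZZ' {Z'}.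
rewrite /box !big_cons /= -/(box l).
have mE : measurable (h @^-1` sval A).
  by rewrite -[X in measurable X]setTI; apply: mh => //; exact: svalP.
have ZA : Z @^-1` sval A = (fun w => (X w, Y w)) @^-1` (h @^-1` sval A).
  by apply/seteqP; split => w /=; rewrite ZE.
rewrite -(indep_seq_behead _ _ (indep_seq_behead _ _ XYs) _ ls) ZA.
rewrite (joint_law_indep _ _ _ _ XYs mE) muleC.
exact: (joint_law X Y _ (measurable_box _)
  (fun A B => indep_seq_box2 _ _ _ _ A B XYs ls) _ mE).
Qed.

(** Tonelli's theorem for the joint law, pulled back to [T]: the inner sample point [w'] acts as an
    independent copy of [w]. *)
Lemma indep_seq_integral2 X Y s (h : R * R -> R) : measurable_fun setT h ->
  (forall z, 0 <= h z) -> indep_seq P [:: X, Y & s] ->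
  (\int[P]_w (h (X w, Y w))%:E = \int[P]_w \int[P]_w' (h (X w, Y w'))%:E)%E.
Proof.
move=> mh h0 XYs.
pose k w := (X w, Y w).
have mk : measurable_fun setT k by exact: measurable_fun_pair.
pose km : {mfun T >-> (R * R)%type} := HB.pack k (isMeasurableFun.Build _ _ _ _ k mk).
have mEh : measurable_fun setT (fun z => (h z)%:E) by exact/measurable_EFinP.
transitivity (\int[distribution P km]_z (h z)%:E)%E.
  by rewrite ge0_integral_distribution// => z; rewrite lee_fin.
transitivity (\int[distribution P X \x distribution P Y]_z (h z)%:E)%E.
  apply: eq_measure_integral => E mE _.
  exact: joint_law_indep XYs mE.
have hge0 z : (0 <= (h z)%:E)%E by rewrite lee_fin.
rewrite (fubini_tonelli1 _ mEh hge0).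
rewrite ge0_integral_distribution//; last 2 first.
- exact: measurable_fun_fubini_tonelli_F.
- by move=> x; apply: integral_ge0.
apply: eq_integral => w _ /=; rewrite /fubini_F.
rewrite ge0_integral_distribution//.
by apply/measurable_EFinP; apply: (measurableT_comp mh); exact: pair1_measurable.
Qed.

End independence.

(** * Expectations of products, and sums over disjoint groups *)

Section independence_products.
Context {R : realType} {dT : measure_display} {T : measurableType dT}.
Variable P : probability T R.
Implicit Types (X Y Z V : {mfun T >-> R}) (s : seq {mfun T >-> R}).

(** Induction on [s] with the head as accumulator: [phi (Z)] and [f (V)] are merged into one
    variable [W]. Keeping [phi] general lets the induction hypothesis apply to [W]. *)
Lemma indep_seq_integral_prod_cons (f : R -> R) (phi : R -> R) Z s :
  measurable_fun setT f -> (forall x, 0 <= f x) ->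
  measurable_fun setT phi -> (forall x, 0 <= phi x) ->
  indep_seq P (Z :: s) ->
  (\int[P]_w (phi (Z w) * \prod_(V <- s) f (V w))%:E =
   \int[P]_w (phi (Z w))%:E * \prod_(V <- s) \int[P]_w (f (V w))%:E)%E.
Proof.
move=> mf f0; elim: s phi Z => [|V s ih] phi Z mphi phi0 ind.
  by rewrite big_nil mule1; apply: eq_integral => w _; rewrite big_nil mulr1.
pose h (z : R * R) := phi z.1 * f z.2.
have mh : measurable_fun setT h.
  by apply: measurable_funM; [exact: (measurableT_comp mphi)|
    exact: (measurableT_comp mf)].
pose k w := h (Z w, V w).
have mk : measurable_fun setT k.
  by apply: (measurableT_comp mh); exact: measurable_fun_pair.
pose W : {mfun T >-> R} := HB.pack k (isMeasurableFun.Build _ _ _ _ k mk).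
(* The next [phi] must be nonnegative on all of [R], which the identity is not; the absolute value
   is, and it fixes [W]. *)
have W0 w : `|W w| = phi (Z w) * f (V w) by rewrite ger0_norm// mulr_ge0.
have indW : indep_seq P (W :: s) by exact: (indep_seq_merge _ _ _ _ _ _ mh _ ind).
under eq_integral do rewrite big_cons mulrA -W0.
rewrite (ih (fun x => `|x|) W (@normr_measurable _ _) (fun=> normr_ge0 _) indW).
rewrite big_cons muleA; congr (_ * _)%E.
under eq_integral do rewrite W0.
rewrite (indep_seq_integral2 _ _ _ _ _ mh _ ind); last first.
  by move=> z; rewrite mulr_ge0.
rewrite /h /=.
under eq_integral do under eq_integral do rewrite EFinM.
have mfV : measurable_fun setT (fun w => (f (V w))%:E).
  by apply/measurable_EFinP; exact: (measurableT_comp mf).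
have mphiZ : measurable_fun setT (fun w => (phi (Z w))%:E).
  by apply/measurable_EFinP; exact: (measurableT_comp mphi).
under eq_integral.
  move=> w _; rewrite ge0_integralZl//; last 2 first.
  - by move=> ? _; rewrite lee_fin.
  - by rewrite lee_fin.
  over.
rewrite ge0_integralZr//; first by move=> ? _; rewrite lee_fin.
by apply: integral_ge0 => ? _; rewrite lee_fin.
Qed.

Lemma indep_seq_integral_prod (f : R -> R) s :
  measurable_fun setT f -> (forall x, 0 <= f x) -> indep_seq P s ->
  (\int[P]_w (\prod_(V <- s) f (V w))%:E =
   \prod_(V <- s) \int[P]_w (f (V w))%:E)%E.
Proof.
move=> mf f0; case: s => [_|V s ind].
  under eq_integral do rewrite big_nil.
  by rewrite big_nil integral_cst//= probability_setT mule1.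
under eq_integral do rewrite big_cons.
by rewrite indep_seq_integral_prod_cons// big_cons.
Qed.

Lemma indep_seq_sum_head (I : Type) (r : seq I) (F : I -> {mfun T >-> R}) X s :
  indep_seq P (X :: map F r ++ s) -> indep_seq P (X + \sum_(i <- r) F i :: s).
Proof.
elim: r X => [|i r ih] X /= ind; first by rewrite big_nil addr0.
rewrite big_cons addrA; apply: ih.
apply: (indep_seq_merge _ X (F i) _ _ (fun z => z.1 + z.2)) => //.
exact: measurable_funD.
Qed.

Lemma indep_seq_sum_groups (J I : Type) (cs : seq J) (i : I) (r : seq I)
    (F : J -> I -> {mfun T >-> R}) s :
  indep_seq P (flatten [seq [seq F c k | k <- i :: r] | c <- cs] ++ s) ->
  indep_seq P ([seq \sum_(k <- i :: r) F c k | c <- cs] ++ s).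
Proof.
elim: cs s => [//|c cs ih] s; rewrite [flatten _]/=.
rewrite -cat_cons -catA => /= /indep_seq_sum_head.
(* The finished sum is rotated into the tail, so that the next group stands at the head for the
   induction hypothesis, and is rotated back afterwards. *)
rewrite -cat1s => /indep_seq_catC; rewrite -catA => /ih /indep_seq_catC.
by rewrite -catA => /indep_seq_catC; rewrite -catA big_cons.
Qed.

End independence_products.

(** Each Borel constraint on [F a] is pulled back through [phi a] to one on [g a]. The order [e] is
    arbitrary so that callers can place the variables to be grouped next to each other. *)
Lemma mutually_independent_seq {R : realType} {dT} {T : measurableType dT}
    (P : probability T R) (I : finType) (g : I -> {mfun T >-> R})
    (F : I -> {mfun T >-> R}) (phi : I -> R -> R) (e : seq I) :
  mutually_independent P (fun a => (g a : T -> R)) ->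
  (forall a, measurable_fun setT (phi a)) ->
  (forall a w, F a w = phi a (g a w)) -> perm_eq e (enum I) ->
  indep_seq P (map F e).
Proof.
move=> ind mphi FE pe l le.
have ue : uniq e by rewrite (perm_uniq pe) enum_uniq.
have sl : size l = size e by rewrite -(size_map F) -le size_map.
(* The set that [l] attaches to [a]; as [e] lists every index exactly once, the default value is
   never reached. *)
pose b a := nth (@MsetT R) (unzip2 l) (index a e).
have bE : unzip2 l = [seq b a | a <- e].
  apply: (@eq_from_nth _ MsetT); first by rewrite !size_map.
  move=> k; rewrite size_map sl; case: (e) ue @b => // a0 e' ue' b ke.
  by rewrite (nth_map a0)// /b index_uniq.
have lE : l = [seq (F a, b a) | a <- e].
  by rewrite -[LHS]zip_unzip le bE zip_map.
rewrite lE /box !big_map /=.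
pose B a := phi a @^-1` sval (b a).
have FB a : F a @^-1` sval (b a) = g a @^-1` B a.
  by apply/seteqP; split => w /=; rewrite /B /= FE.
under eq_bigr do rewrite FB.
under [RHS]eq_bigr do rewrite FB.
have mB a : measurable (B a).
  by rewrite -[X in measurable X]setTI; apply: mphi => //; exact: svalP.
rewrite !(perm_big _ pe) /= !big_enum /= -(ind B mB); congr (P _).
rewrite (_ : [set: I] = [set` index_enum I]) ?bigcap_seq//.
by apply/seteqP; split => a _ //=; rewrite mem_index_enum.
Qed.

(** * Gaussian integrals and sums of independent Gaussians *)

(* The Gaussian integral that N(0, v) satisfies. Keeping [y] free makes it stable
   under sums of independent variables, so the law of a sum is never computed;
   [lam] may be negative. *)
Definition gauss_like {R : realType} {dT} {T : measurableType dT}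
  (P : probability T R) (v : R) (X : T -> R) : Prop :=
  forall lam y : R, 0 < 1 + lam * v ->
  (\int[P]_w (expR (- (lam / 2 * (y + X w) ^+ 2)))%:E =
   ((Num.sqrt (1 + lam * v))^-1 *
     expR (- (lam / (1 + lam * v) / 2 * y ^+ 2)))%:E)%E.

Lemma measurable_expR_sqr {R : realType} {d} {T : measurableType d}
    (c : R) (f : T -> R) : measurable_fun setT f ->
  measurable_fun setT (fun w => expR (- (c * f w ^+ 2))).
Proof.
move=> mf; apply: measurableT_comp => //; apply: measurableT_comp => //.
by apply: measurable_funM => //; exact: measurable_funX.
Qed.

Section gaussian_integrals.
Context {R : realType}.

(** The Radon-Nikodym derivative of [normal_prob] and [normal_pdf] have the same integral over every
    measurable set, hence agree almost everywhere. *)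
Lemma integral_normal_prob (m s : R) (f : measurableTypeR R -> \bar R) :
  measurable_fun setT f -> (forall x, (0 <= f x)%E) ->
  (\int[normal_prob m s]_x f x =
   \int[lebesgue_measure]_x (f x * (normal_pdf m s x)%:E))%E.
Proof.
move=> mf f0.
pose nu : {finite_measure set (measurableTypeR R) -> \bar R} := normal_prob m s.
have dom : nu `<< lebesgue_measure by exact: normal_prob_dominates.
have mpdf : measurable_fun setT (fun x : measurableTypeR R => (normal_pdf m s x)%:E).
  by apply/measurable_EFinP; exact: measurable_normal_pdf.
have iRN := Radon_Nikodym_SigmaFinite.f_integrable dom.
rewrite -(Radon_Nikodym_SigmaFinite.change_of_variables dom f0 measurableT mf).
apply: ge0_ae_eq_integral => //.
- by apply: emeasurable_funM => //; exact: measurable_int iRN.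
- exact: emeasurable_funM.
- by move=> x _; rewrite mule_ge0// Radon_Nikodym_SigmaFinite.f_ge0.
- by move=> x _; rewrite mule_ge0// lee_fin normal_pdf_ge0.
apply: ae_eqe_mul2l; apply: integral_ae_eq => //.
by move=> E _ mE; rewrite -(Radon_Nikodym_SigmaFinite.f_integral dom).
Qed.

(** Completing the square in [x]: the tilted density is a constant times another normal density,
    whose total mass is 1 once integrated. *)
Lemma normal_pdf_tilt (lam a y x : R) : 0 < 1 + lam * a ^+ 2 ->
  expR (- (lam / 2 * (y + a * x) ^+ 2)) * normal_pdf 0 1 x =
  (Num.sqrt (1 + lam * a ^+ 2))^-1 *
    expR (- (lam / (1 + lam * a ^+ 2) / 2 * y ^+ 2)) *
  normal_pdf (- (lam * a * y / (1 + lam * a ^+ 2)))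
    (Num.sqrt (1 + lam * a ^+ 2))^-1 x.
Proof.
set k := 1 + _ => k0.
have kn0 : k != 0 by rewrite gt_eqF.
have sk0 : 0 < Num.sqrt k by rewrite sqrtr_gt0.
have sk2 : Num.sqrt k ^+ 2 = k by rewrite sqr_sqrtr// ltW.
have pi0 : 0 < pi :> R by exact: pi_gt0.
rewrite !normal_pdfE ?oner_eq0 ?invr_eq0 ?gt_eqF// /normal_peak /normal_fun.
have -> : (Num.sqrt ((Num.sqrt k)^-1 ^+ 2 * pi *+ 2))^-1 =
    Num.sqrt k * (Num.sqrt (1 ^+ 2 * pi *+ 2))^-1.
  rewrite exprVn sk2 expr1n mul1r -mulrnAr sqrtrM ?invr_ge0 ?ltW//.
  by rewrite sqrtrV ?ltW// invfM invrK.
set c := (Num.sqrt (1 ^+ 2 * pi *+ 2))^-1.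
rewrite mulrCA -expRD.
rewrite [RHS](_ : _ = c * (expR (- (lam / k / 2 * y ^+ 2)) *
   expR (- (x - - (lam * a * y / k)) ^+ 2 / ((Num.sqrt k)^-1 ^+ 2 *+ 2)))); last first.
  by field; rewrite gt_eqF.
rewrite -expRD exprVn sk2; congr (_ * expR _).
by rewrite /k; field; rewrite -/k kn0.
Qed.

Lemma gauss_like_normal {dT} {T : measurableType dT} (P : probability T R)
    (g : {mfun T >-> R}) (a : R) :
  std_normal P g -> gauss_like P (a ^+ 2) (fun w => a * g w).
Proof.
move=> gN lam y k0.
pose G : T -> measurableTypeR R := g.
have mG : measurable_fun setT G.
  by move=> _ B mB; rewrite setTI; exact: (measurable_preimage g B).
pose f (x : measurableTypeR R) := (expR (- (lam / 2 * (y + a * x) ^+ 2)))%:E.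
have mf : measurable_fun setT f.
  by apply/measurable_EFinP/measurable_expR_sqr; exact: measurable_funD.
have f0 x : (0 <= f x)%E by rewrite lee_fin expR_ge0.
transitivity (\int[pushforward P G]_x f x)%E.
  by rewrite (ge0_integral_pushforward mG).
transitivity (\int[normal_prob 0 1]_x f x)%E.
  by apply: (eq_measure_integral (normal_prob 0 1)) => A mA _; exact: gN.
rewrite integral_normal_prob// /f.
under eq_integral do rewrite -EFinM normal_pdf_tilt// EFinM.
rewrite ge0_integralZl//=.
- by rewrite integral_normal_pdf mule1.
- by apply/measurable_EFinP; exact: measurable_normal_pdf.
- by move=> x _; rewrite lee_fin normal_pdf_ge0.
Qed.

(** Integrating over [Y] first, with shift [y + X], leaves the same kind of integral over [X] with
    [lam] replaced by [lam / (1 + lam * v)]. The two normalising factors multiply to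
    [1 + lam * (u + v)]. *)
Lemma gauss_likeD {dT} {T : measurableType dT} (P : probability T R)
    (X Y : {mfun T >-> R}) s (u v : R) : 0 <= u -> 0 <= v ->
  indep_seq P [:: X, Y & s] -> gauss_like P u X -> gauss_like P v Y ->
  gauss_like P (u + v) (X + Y : {mfun T >-> R}).
Proof.
move=> u0 v0 ind gX gY lam y k0.
(* For negative [lam], the smaller variance [v] gives the larger value, so positivity is inherited
   from [u + v]. *)
have l0 : 0 < 1 + lam * v.
  have [lam0|lam0] := leP 0 lam; first by rewrite ltr_pwDl// mulr_ge0.
  by apply: lt_le_trans k0 _; rewrite lerD2l ler_nM2l// lerDr.
pose h (z : R * R) := expR (- (lam / 2 * (y + (z.1 + z.2)) ^+ 2)).
have mh : measurable_fun setT h.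
  apply: measurable_expR_sqr.
  by apply: measurable_funD => //; exact: measurable_funD.
have := indep_seq_integral2 _ _ _ _ h mh (fun z => expR_ge0 _) ind.
rewrite /h /= => ->.
under eq_integral do under eq_integral do rewrite addrA.
under eq_integral do rewrite gY// EFinM.
rewrite ge0_integralZl//=; last first.
  by apply/measurable_EFinP/measurable_expR_sqr; exact: measurable_funD.
have E : 1 + lam / (1 + lam * v) * u = (1 + lam * (u + v)) / (1 + lam * v).
  by field; rewrite gt_eqF.
rewrite gX E ?divr_gt0// -EFinM mulrA; congr (_ * expR _)%:E.
  by rewrite -invfM -sqrtrM ?ltW// mulrCA divff ?mulr1 ?gt_eqF.
by congr (- (_ / 2 * _)); field; rewrite !gt_eqF.
Qed.

Lemma gauss_like_sum {dT} {T : measurableType dT} (P : probability T R)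
    (I : Type) (r : seq I) (F : I -> {mfun T >-> R}) (v : I -> R) X u s :
  indep_seq P (X :: map F r ++ s) -> 0 <= u -> (forall i, 0 <= v i) ->
  gauss_like P u X -> (forall i, gauss_like P (v i) (F i)) ->
  gauss_like P (u + \sum_(i <- r) v i) (X + \sum_(i <- r) F i : {mfun T >-> R}).
Proof.
move=> + + v0 + gF; elim: r X u => [|i r ih] X u ind u0 gX.
  by rewrite !big_nil !addr0.
rewrite !big_cons !addrA; apply: ih.
- by have := indep_seq_sum_head P I [:: i] F X (map F r ++ s) ind; rewrite big_seq1.
- exact: addr_ge0.
- exact: (gauss_likeD _ _ _ _ _ _ _ _ ind).
Qed.

End gaussian_integrals.

(** * Exponential moments of the squared norm of a Gaussian vector *)

(** The coordinates use disjoint columns of [g], hence are independent, and each contributes the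
    Gaussian integral at [y = 0]. Nonemptiness of [K] supplies the head from which each sum is
    accumulated. *)
Lemma integral_expR_sqnorm {R : realType} {dT} {T : measurableType dT}
    (P : probability T R) (K : finType) (d : nat)
    (g : K * 'I_d -> {mfun T >-> R}) (alpha : K -> R) (lam : R) :
  (forall a, std_normal P (g a)) ->
  mutually_independent P (fun a => (g a : T -> R)) ->
  0 < 1 + lam * \sum_k alpha k ^+ 2 -> (0 < #|K|)%N ->
  (\int[P]_w (expR (- (lam / 2 *
      sqnorm (fun c => \sum_k alpha k * g (k, c) w))))%:E =
   ((Num.sqrt (1 + lam * \sum_k alpha k ^+ 2))^-1 ^+ d)%:E)%E.
Proof.
move=> gN ind; set v := \sum_k _ => lv K0.
pose F c k : {mfun T >-> R} := scale_mfun (alpha k) (g (k, c)).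
have FE a w : F a.2 a.1 w = alpha a.1 * g a w.
  by case: a => k c; rewrite /= mulrC.
have indF e : perm_eq e (enum {: K * 'I_d}) ->
    indep_seq P [seq F a.2 a.1 | a : K * 'I_d <- e].
  move=> pe; apply: (mutually_independent_seq P _ g _ (fun a x => alpha a.1 * x) _ ind) => //.
  by move=> a; exact: mulrl_measurable.
have [k0 [r Kr]] : exists k0 r, enum K = k0 :: r.
  by move: K0; rewrite cardE; case: (enum K) => // k0 r _; exists k0, r.
pose S c : {mfun T >-> R} := \sum_(k <- k0 :: r) F c k.
have SE c w : S c w = \sum_k alpha k * g (k, c) w.
  rewrite mfun_sum -Kr big_enum /=; apply: eq_bigr => k _.
  exact: (FE (k, c)).
have gS c : gauss_like P v (S c).
  (* Column [c] is listed first, so its entries can be summed while the others form the tail. *)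
  have pe : perm_eq ([seq (k, c) | k <- enum K] ++
      [seq a <- enum {: K * 'I_d} | a.2 != c]) (enum {: K * 'I_d}).
    apply: uniq_perm; last 2 first.
    - exact: enum_uniq.
    - move=> [k c']; rewrite mem_cat mem_filter mem_enum/= andbT.
      case: eqVneq => [->|_]; rewrite ?orbT ?orbF//.
      by apply/mapP; exists k; rewrite ?mem_enum.
    rewrite cat_uniq; apply/and3P; split.
    - by rewrite map_inj_uniq ?enum_uniq// => ? ? [].
    - apply/hasPn => a; rewrite mem_filter => /andP[ac _].
      by apply/mapP => -[k _ ak]; move: ac; rewrite ak eqxx.
    - by rewrite filter_uniq// enum_uniq.
  have := indF _ pe; rewrite map_cat -map_comp Kr map_cons cat_cons => indc.
  have -> : v = alpha k0 ^+ 2 + \sum_(k <- r) alpha k ^+ 2.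
    by rewrite /v -big_enum Kr big_cons.
  rewrite /S big_cons.
  apply: (gauss_like_sum P _ r (F c) _ _ _ _ indc) => //.
  - exact: sqr_ge0.
  - by move=> k; exact: sqr_ge0.
  - have -> : (F c k0 : T -> R) = fun w => alpha k0 * g (k0, c) w.
      by apply/funext => w; exact: (FE (k0, c)).
    exact: gauss_like_normal.
  - move=> k; have -> : (F c k : T -> R) = fun w => alpha k * g (k, c) w.
      by apply/funext => w; exact: (FE (k, c)).
    exact: gauss_like_normal.
have indS : indep_seq P [seq S c | c <- enum 'I_d].
  rewrite -[X in indep_seq P X]cats0; apply: indep_seq_sum_groups.
  rewrite cats0 -Kr.
  (* Listing the entries column by column makes each coordinate a consecutive group. *)
  rewrite (_ : flatten _ = [seq F a.2 a.1 |
    a : K * 'I_d <- [seq (k, c) | c <- enum 'I_d, k <- enum K]]); last first.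
    rewrite map_flatten; congr flatten; rewrite -[RHS]map_comp.
    apply: eq_map => c /=.
    by rewrite -map_comp.
  apply: indF; apply: uniq_perm; rewrite ?enum_uniq//.
    by apply: allpairs_uniq; rewrite ?enum_uniq// => -[? ?] [? ?] _ _ /= [-> ->].
  move=> [k c]; rewrite mem_enum; apply/allpairsP.
  by exists (c, k); rewrite !mem_enum.
pose f (x : R) := expR (- (lam / 2 * x ^+ 2)).
have mf : measurable_fun setT f by exact: measurable_expR_sqr.
have := indep_seq_integral_prod P f _ mf (fun=> expR_ge0 _) indS.
under eq_integral do rewrite big_map big_enum /= -expR_sum.
under eq_integral => w _.
  under eq_bigr do rewrite SE.
  rewrite sumrN -mulr_sumr -/(sqnorm _).
  over.
move=> ->; rewrite big_map big_enum /=.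
have fS c : (\int[P]_w (f (S c w))%:E = (Num.sqrt (1 + lam * v))^-1%:E)%E.
  have := gS c lam 0 lv; rewrite expr0n/= mulr0 oppr0 expR0 mulr1.
  by under eq_integral do rewrite add0r.
under eq_bigr do rewrite fS.
by rewrite prodEFin prodr_const card_ord.
Qed.

(** * Decoupled Chernoff bound *)

(* Chernoff's bound, where AM-GM replaces Cauchy-Schwarz to decouple [U] and
   [V]: only their separate exponential moments are needed. *)
Lemma chernoff_diff {R : realType} {dT} {T : measurableType dT}
    (P : probability T R) (U V : T -> R) (theta a b : R) :
  measurable_fun setT U -> measurable_fun setT V ->
  0 <= theta -> 0 < a -> 0 < b ->
  (\int[P]_w (expR (theta / 2 * V w))%:E <= a%:E)%E ->
  (\int[P]_w (expR (- (theta / 2 * U w)))%:E <= b%:E)%E ->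
  (P [set w | (U w - V w < 0)%R] <= (Num.sqrt (a * b))%:E)%E.
Proof.
move=> mU mV t0 a0 b0 Va Ub.
have mE : measurable [set w | U w - V w < 0].
  have := measurable_funB mU mV measurableT (measurable_itv `]-oo, (0 : R)[).
  rewrite setTI (_ : _ @^-1` _ = [set w | U w - V w < 0])//.
have meV : measurable_fun setT (fun w => expR (theta / 2 * V w)).
  by apply: measurableT_comp => //; exact: measurable_funM.
have meU : measurable_fun setT (fun w => expR (- (theta / 2 * U w))).
  by do 2 apply: measurableT_comp => //; exact: measurable_funM.
pose sa := Num.sqrt a; pose sb := Num.sqrt b.
have sa0 : 0 < sa by rewrite sqrtr_gt0.
have sb0 : 0 < sb by rewrite sqrtr_gt0.
(* The weights are balanced so that each of the two terms integrates to at most [sa * sb / 2]. *)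
pose p w := sb / sa / 2 * expR (theta / 2 * V w).
pose q w := sa / sb / 2 * expR (- (theta / 2 * U w)).
have p0 w : 0 <= p w by rewrite !mulr_ge0 ?invr_ge0 ?expR_ge0 ?(ltW sa0) ?(ltW sb0).
have q0 w : 0 <= q w by rewrite !mulr_ge0 ?invr_ge0 ?expR_ge0 ?(ltW sa0) ?(ltW sb0).
have mp : measurable_fun setT p by exact: measurable_funM.
have mq : measurable_fun setT q by exact: measurable_funM.
(* On the event [p * q >= 1/4], so [(p + q) ^ 2 >= 4 * p * q >= 1]. *)
have key w : U w - V w < 0 -> 1 <= p w + q w.
  move=> UV.
  have pq : 1 / 4 <= p w * q w.
    rewrite (_ : p w * q w = 1 / 4 * (expR (theta / 2 * V w) * expR (- (theta / 2 * U w)))).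
      rewrite -expRD ler_peMr// -[leLHS]expR0 ler_expR -mulrBr mulr_ge0//.
        by rewrite divr_ge0.
      by rewrite subr_ge0 ltW// -subr_lt0.
    by rewrite /p /q; field; rewrite !gt_eqF.
  have := p0 w; have := q0 w.
  have : 0 <= (p w - q w) ^+ 2 by exact: sqr_ge0.
  nra.
apply: (@le_trans _ _ (\int[P]_w (p w + q w)%:E)%E).
  rewrite -[X in P X]setIT -integral_indic//.
  apply: ge0_le_integral => //.
  - exact/measurable_EFinP/measurable_indic.
  - exact/measurable_EFinP/measurable_funD.
  - move=> w _; rewrite lee_fin indicE.
    by case: (boolP (_ \in _)) => [/set_mem/key//|_]; rewrite addr_ge0.
under eq_integral do rewrite EFinD.
rewrite ge0_integralD//; [|by move=> w _; rewrite lee_fin|exact/measurable_EFinP|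
  by move=> w _; rewrite lee_fin|exact/measurable_EFinP].
have c0 x y : 0 < x -> 0 < y -> 0 <= x / y / 2 :> R.
  by move=> x0 y0; rewrite !divr_ge0// ltW.
under eq_integral do rewrite EFinM.
under [X in (_ + X)%E]eq_integral do rewrite EFinM.
rewrite !ge0_integralZl//= ?lee_fin ?c0//; [|exact/measurable_EFinP|exact/measurable_EFinP].
apply: (le_trans (leeD (lee_wpmul2l _ Va) (lee_wpmul2l _ Ub))); rewrite ?lee_fin ?c0//.
rewrite sqrtrM ?(ltW a0)// -/sa -/sb.
rewrite -[in leLHS](sqr_sqrtr (ltW a0)) -[in leLHS](sqr_sqrtr (ltW b0)) -/sa -/sb.
by rewrite le_eqVlt; apply/orP; left; apply/eqP; field; rewrite !gt_eqF.
Qed.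

(** * Linear coefficients of a point minus a centroid, and their norms *)

(* Coordinate [c] of the point [x_l] is
   [\sum_a point_coef n z sigma l a * g (a, c)]. *)
Definition point_coef {R : realType} (n : nat) (z : 'I_n -> 'I_2) (sigma : R)
    (l : 'I_n) (a : 'I_2 + 'I_n) : R :=
  match a with inl b => (z l == b)%:R | inr l' => sigma * (l' == l)%:R end.

(* The same for [x_i] minus the centroid of cluster [k]. *)
Definition diff_coef {R : realType} (n : nat) (z : 'I_n -> 'I_2) (sigma : R)
    (C : 'I_n -> 'I_2) (k : 'I_2) (i : 'I_n) (a : 'I_2 + 'I_n) : R :=
  point_coef n z sigma i a -
  #|Defs.cluster C k|%:R^-1 * \sum_(l in Defs.cluster C k) point_coef n z sigma l a.

Lemma sum_point_coef {R : realType} (n : nat) (z : 'I_n -> 'I_2) (sigma : R)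
    (l : 'I_n) (h : 'I_2 + 'I_n -> R) :
  \sum_a point_coef n z sigma l a * h a = h (inl (z l)) + sigma * h (inr l).
Proof.
rewrite big_sumType /=; congr (_ + _).
  rewrite (bigD1 (z l))//= eqxx mul1r big1 ?addr0// => b.
  by rewrite eq_sym => /negbTE ->; rewrite mul0r.
rewrite (bigD1 l)//= eqxx mulr1 big1 ?addr0// => l' /negbTE ->.
by rewrite mulr0 mul0r.
Qed.

Lemma sum_diff_coef {R : realType} (n : nat) (z : 'I_n -> 'I_2) (sigma : R)
    (C : 'I_n -> 'I_2) (k : 'I_2) (i : 'I_n) (h : 'I_2 + 'I_n -> R) :
  \sum_a diff_coef n z sigma C k i a * h a =
  h (inl (z i)) + sigma * h (inr i) - #|Defs.cluster C k|%:R^-1 *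
    \sum_(l in Defs.cluster C k) (h (inl (z l)) + sigma * h (inr l)).
Proof.
under eq_bigr do rewrite mulrBl -mulrA mulr_suml.
rewrite big_split /= sumrN sum_point_coef -mulr_sumr exchange_big /=.
by under [in LHS]eq_bigr do rewrite sum_point_coef.
Qed.

Section coefficient_norms.
Context {R : realType} (n : nat) (z C : 'I_n -> 'I_2) (sigma : R).
Context (k : 'I_2) (i : 'I_n).
Let m : R := #|Defs.cluster C k|%:R.
Hypothesis m0 : (0 < #|Defs.cluster C k|)%N.

Let mR : 0 < m. Proof. by rewrite ltr0n. Qed.

(** The coefficient of noise [l] is [sigma] times the indicator of [l = i] minus [1/m] times that of
    cluster [k]. The cross term survives only when [i] belongs to the cluster. *)
Lemma noise_coef_norm :
  \sum_l diff_coef n z sigma C k i (inr l) ^+ 2 =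
  sigma ^+ 2 * (1 - (C i == k)%:R * 2 / m + m^-1).
Proof.
have E l : diff_coef n z sigma C k i (inr l) ^+ 2 =
    sigma ^+ 2 * ((l == i)%:R - 2 / m * ((l == i)%:R * (C l == k)%:R) +
    m^-1 ^+ 2 * (C l == k)%:R).
  rewrite /diff_coef /= -/m.
  have -> : \sum_(l0 in Defs.cluster C k) sigma * (l == l0)%:R = sigma * (C l == k)%:R.
    rewrite -mulr_sumr; congr (_ * _).
    have [lk|lk] := boolP (C l == k).
      rewrite (bigD1 l) ?inE//= eqxx big1 ?addr0// => l' /andP[_].
      by rewrite eq_sym => /negbTE ->.
    rewrite big1// => l' l'k; case: eqP => // ll'.
    by move: lk l'k; rewrite ll' inE => /negbTE ->.
  by case: (l == i); case: (C l == k) => /=; field; rewrite gt_eqF.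
under eq_bigr do rewrite E.
rewrite -mulr_sumr !big_split /= sumrN -!mulr_sumr; congr (_ * _).
have -> : \sum_l (l == i)%:R = 1 :> R.
  by rewrite (bigD1 i)//= eqxx big1 ?addr0// => l /negbTE ->.
have -> : \sum_l ((l == i)%:R * (C l == k)%:R) = (C i == k)%:R :> R.
  rewrite (bigD1 i)//= eqxx mul1r big1 ?addr0// => l /negbTE ->.
  by rewrite mul0r.
have -> : \sum_l (C l == k)%:R = m :> R.
  rewrite /m -sum1_card [in RHS]big_mkcond natr_sum; apply: eq_bigr => l _.
  by rewrite inE; case: eqP.
by field; rewrite gt_eqF.
Qed.

(** With [f b] the fraction of the cluster labelled [b], the coefficients are [1 - f (z i)] and
    [- f b]. The latter fractions add up to [1 - f (z i)], and [f (z i) >= 1/m] because [i] itself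
    is in the cluster. *)
Lemma mean_coef_norm : C i = k ->
  \sum_b diff_coef n z sigma C k i (inl b) ^+ 2 <= 2 * (1 - m^-1) ^+ 2.
Proof.
move=> Ci.
pose f b : R := m^-1 * \sum_(l in Defs.cluster C k) (z l == b)%:R.
have f0 b : 0 <= f b.
  by rewrite mulr_ge0 ?invr_ge0 ?(ltW mR)// sumr_ge0.
have fs : \sum_b f b = 1.
  rewrite -mulr_sumr exchange_big /=.
  under eq_bigr => l _.
    rewrite (bigD1 (z l))//= eqxx big1 ?addr0; last first.
      by move=> b; rewrite eq_sym => /negbTE ->.
    over.
  by rewrite sumr_const -/m mulVf// gt_eqF.
have fz : m^-1 <= f (z i).
  rewrite /f (bigD1 i) ?inE ?Ci//= eqxx mulrDr mulr1 lerDl.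
  by rewrite mulr_ge0 ?invr_ge0 ?(ltW mR)// sumr_ge0.
rewrite (bigD1 (z i))//=.
have E b : diff_coef n z sigma C k i (inl b) = (z i == b)%:R - f b by [].
have fle : \sum_(b | b != z i) f b = 1 - f (z i).
  by rewrite -fs [in RHS](bigD1 (z i))//= addrAC subrr add0r.
(* For nonnegative numbers, the sum of squares is at most the square of the sum. *)
have rest : \sum_(b | b != z i) diff_coef n z sigma C k i (inl b) ^+ 2 <=
    (1 - f (z i)) ^+ 2.
  rewrite -fle expr2 mulr_suml; apply: ler_sum => b bz.
  rewrite E eq_sym (negbTE bz) sub0r sqrrN expr2 ler_wpM2l//.
  by rewrite (bigD1 b)//= lerDl sumr_ge0.
have f1 : 0 <= 1 - f (z i) by rewrite -fle sumr_ge0.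
have : (1 - f (z i)) ^+ 2 <= (1 - m^-1) ^+ 2.
  by rewrite ler_pXn2r ?nnegrE// ?lerD2l ?lerN2// (le_trans f1)// lerD2l lerN2.
rewrite E eqxx /= => f2; apply: (le_trans (lerD f2 (le_trans rest f2))).
by rewrite mulr_natl mulr2n.
Qed.

End coefficient_norms.

Lemma diff_coef_same {R : realType} (n : nat) (z C : 'I_n -> 'I_2) (sigma M : R)
    (i : 'I_n) : (0 < #|Defs.cluster C (C i)|)%N -> #|Defs.cluster C (C i)|%:R <= M ->
  \sum_a diff_coef n z sigma C (C i) i a ^+ 2 <=
  2 * (1 - M^-1) ^+ 2 + sigma ^+ 2 * (1 - M^-1).
Proof.
move=> m0 mM; have mR : 0 < #|Defs.cluster C (C i)|%:R :> R by rewrite ltr0n.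
have m1 : #|Defs.cluster C (C i)|%:R^-1 <= 1 :> R by rewrite invf_le1// ler1n.
have iM : M^-1 <= #|Defs.cluster C (C i)|%:R^-1.
  by rewrite lef_pV2// posrE// (lt_le_trans mR).
rewrite big_sumType /= noise_coef_norm// eqxx mul1r.
apply: lerD; first apply: (le_trans (mean_coef_norm _ _ _ _ _ _ m0 erefl)).
  rewrite ler_pM2l// ler_pXn2r ?nnegrE ?subr_ge0//; first by rewrite lerD2l lerN2.
  exact: le_trans m1.
rewrite ler_wpM2l ?sqr_ge0//.
nra.
Qed.

(** The center part is bounded below by 0, and the noise part decreases with the cluster size. *)
Lemma diff_coef_other {R : realType} (n : nat) (z C : 'I_n -> 'I_2) (sigma M : R)
    (k : 'I_2) (i : 'I_n) : C i != k ->
  (0 < #|Defs.cluster C k|)%N -> #|Defs.cluster C k|%:R <= M ->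
  sigma ^+ 2 * (1 + M^-1) <= \sum_a diff_coef n z sigma C k i a ^+ 2.
Proof.
move=> ik m0 mM; have mR : 0 < #|Defs.cluster C k|%:R :> R by rewrite ltr0n.
rewrite big_sumType /= noise_coef_norm// (negbTE ik) !mul0r subr0.
rewrite ler_wpDl ?sumr_ge0//; first by move=> *; exact: sqr_ge0.
by rewrite ler_wpM2l ?sqr_ge0// lerD2l lef_pV2// posrE// (lt_le_trans mR).
Qed.

(** * The constant [rho_q] in terms of the two variance bounds *)

Lemma rho_q_balanced {R : realType} (n : nat) (q sigma : R) (M : R) :
  Num.sqrt n%:R * q + n%:R = 2 * M -> 0 < M ->
  let u := sigma ^+ 2 * (1 + M^-1) in
  let v := 2 * (1 - M^-1) ^+ 2 + sigma ^+ 2 * (1 - M^-1) in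
  0 < u -> 0 < v ->
  rho_q n q sigma = 4 * u * v / (u + v) ^+ 2.
Proof.
move=> sM M0 u v u0 v0; rewrite /rho_q /=.
set s := Num.sqrt _ in sM *.
have s2 : s ^+ 2 = n%:R by rewrite sqr_sqrtr.
have -> : s * q + n%:R - 2 = 2 * M - 2 by rewrite sM.
have -> : s * (sigma ^+ 2 + 2) * (s + q) - 4 = 2 * M * (sigma ^+ 2 + 2) - 4.
  by rewrite -sM -s2; ring.
have -> : n%:R * sigma ^+ 2 * (s + q) ^+ 2 = (2 * M) ^+ 2 * sigma ^+ 2.
  by rewrite -sM -s2; ring.
rewrite sM.
have uv : (u + v) * (2 * M ^+ 2) = (2 * M) ^+ 2 * sigma ^+ 2 + (2 * M - 2) ^+ 2.
  by rewrite /u /v; field; rewrite gt_eqF.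
rewrite -uv.
(* This is [(u + v) * M ^ 2], in the expanded form in which [field] asks for it to be nonzero. *)
have D0 : sigma ^+ 2 * (M + 1) * M +
    (2 * (M - 1) ^+ 2 + sigma ^+ 2 * (M - 1) * M) != 0.
  rewrite (_ : _ + _ = (u + v) * M ^+ 2); last first.
    by rewrite /u /v; field; rewrite gt_eqF.
  by rewrite gt_eqF//; exact: mulr_gt0 (addr_gt0 u0 v0) (exprn_gt0 2 M0).
by rewrite /u /v; field; rewrite D0 gt_eqF.
Qed.

Lemma powR_quarter {R : realType} (r : R) (d : nat) : 0 <= r ->
  r `^ (d%:R / 4) = Num.sqrt (Num.sqrt r ^+ d).
Proof.
move=> r0; rewrite -!powR12_sqrt ?exprn_ge0 ?sqrtr_ge0//; last exact: powR_ge0.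
by rewrite -powR_mulrn ?powR_ge0// -!powRrM; congr (_ `^ _); field.
Qed.

(** * Choice of the tilt and assembly of the probability bound *)

(* g (inl k, c) = c-th coordinate of mu*_k ; g (inr i, c) = c-th coordinate
   of xi_i / sigma.  All coordinates i.i.d. N(0,1). *)
Theorem theorem3p6 (R : realType) (dT : measure_display) (T : measurableType dT)
  (P : probability T R) (n d : nat) (hn : (2 <= n)%N) (hd : (1 <= d)%N)
  (g : ('I_2 + 'I_n) * 'I_d -> {RV P >-> R})
  (hnorm : forall a, std_normal P (g a))
  (hind : mutually_independent P (fun a => (g a : T -> R)))
  (z : 'I_n -> 'I_2)
  (hz0 : exists i, z i = ord0) (hz1 : exists i, z i = ord_max)
  (q : R) (hq : 1 < q) (C : 'I_n -> 'I_2) (hC : approx_balanced q C)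
  (i : 'I_n) (beta : R) (hbeta : 1 < beta) (sigma : R)
  (hsigma : sigma = beta * (Num.sqrt (n%:R) * q + n%:R - 2)
                   / (Num.sqrt 2 * Num.sqrt (Num.sqrt (n%:R) * q + n%:R))) :
  let mu (k : 'I_2) (w : T) : 'I_d -> R := fun c => g (inl k, c) w in
  let xi (l : 'I_n) (w : T) : 'I_d -> R := fun c => sigma * g (inr l, c) w in
  let x (w : T) : 'I_n -> 'I_d -> R := fun l c => mu (z l) w c + xi l w c in
  let j := C i in
  (P [set w | (sqnorm (fun c => x w i c - centroid C (x w) (other j) c)
              - sqnorm (fun c => x w i c - centroid C (x w) j c) < 0)%R]
   <= ((rho_q n q sigma) `^ (d%:R / 4))%R%:E)%E.
Proof.
pose x (w : T) (l : 'I_n) (c : 'I_d) : R :=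
  g (inl (z l), c) w + sigma * g (inr l, c) w.
pose j := C i.
suff : (P [set w | (sqnorm (fun c => x w i c - centroid C (x w) (other j) c)
              - sqnorm (fun c => x w i c - centroid C (x w) j c) < 0)%R]
   <= ((rho_q n q sigma) `^ (d%:R / 4))%R%:E)%E by [].
(* Since [sqrt (n / 4) = sqrt n / 2], this is the upper end of the balance interval. *)
pose M := (Num.sqrt n%:R * q + n%:R) / 2.
have sM : Num.sqrt n%:R * q + n%:R = 2 * M by rewrite /M; field.
have mM k : (#|Defs.cluster C k|%:R <= M).
  have [_ [_ /ltW]] := hC k.
  rewrite sqrtrM// (_ : Num.sqrt (4^-1) = 2^-1); last first.
    by rewrite (_ : 4^-1 = 2^-1 ^+ 2) ?sqrtr_sqr ?ger0_norm//; field.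
  by move/le_trans; apply; rewrite le_eqVlt /M; apply/orP; left; apply/eqP; field.
have m0 k : (0 < #|Defs.cluster C k|)%N by have [/ltnW/ltnW] := hC k.
have M1 : 1 < M.
  apply: lt_le_trans (mM ord0); rewrite ltr1n.
  by have [/ltnW] := hC ord0.
have M0 : 0 < M by exact: lt_trans M1.
have s2 : sigma ^+ 2 = beta ^+ 2 * ((M - 1) ^+ 2 / M).
  rewrite hsigma sM exprMn exprVn [X in _ / X]exprMn.
  rewrite sqr_sqrtr// (sqr_sqrtr (mulr_ge0 _ (ltW M0)))//.
  by field; rewrite gt_eqF.
pose u := sigma ^+ 2 * (1 + M^-1).
pose v := 2 * (1 - M^-1) ^+ 2 + sigma ^+ 2 * (1 - M^-1).
have iM : M^-1 < 1 by rewrite invf_lt1.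
have iM0 : 0 < M^-1 by rewrite invr_gt0.
have b0 : 0 < beta by exact: lt_trans hbeta.
have M10 : 0 < M - 1 by rewrite subr_gt0.
have sig0 : 0 < sigma ^+ 2.
  rewrite s2; exact: mulr_gt0 (exprn_gt0 2 b0) (divr_gt0 (exprn_gt0 2 M10) M0).
have u0 : 0 < u by rewrite mulr_gt0// addr_gt0.
have v0 : 0 < v.
  by rewrite addr_gt0// mulr_gt0 ?subr_gt0// exprn_gt0// subr_gt0.
(* The gap is [2 * (beta ^ 2 - 1) * ((M - 1) / M) ^ 2], positive because [beta > 1]. *)
have vu : v < u.
  rewrite -subr_gt0 (_ : u - v = 2 * (beta ^+ 2 - 1) * ((M - 1) / M) ^+ 2).
    apply: mulr_gt0; last exact: (exprn_gt0 2 (divr_gt0 M10 M0)).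
    by apply: mulr_gt0 => //; rewrite subr_gt0 exprn_egt1.
  by rewrite /u /v s2; field; rewrite gt_eqF.
(* This value maximises [(1 - theta * v) * (1 + theta * u)], with maximum
   [(u + v) ^ 2 / (4 * u * v)]. *)
pose theta := (u - v) / (2 * u * v).
have t0 : 0 < theta.
  by apply: divr_gt0; rewrite ?subr_gt0//; exact: (mulr_gt0 (mulr_gt0 (ltr0Sn _ 1) u0) v0).
have tv : 1 + (- theta) * v = (u + v) / (2 * u).
  by rewrite /theta; field; rewrite !gt_eqF.
have tu : 1 + theta * u = (u + v) / (2 * v).
  by rewrite /theta; field; rewrite !gt_eqF.
pose alpha k := diff_coef n z sigma C k i.
have xE k w c : x w i c - centroid C (x w) k c = \sum_a alpha k a * g (a, c) w.
  by rewrite (sum_diff_coef n z sigma C k i (fun a => g (a, c) w)).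
have cardK : (0 < #|{: 'I_2 + 'I_n}|)%N.
  by apply/card_gt0P; exists (inl ord0).
have av : \sum_a alpha j a ^+ 2 <= v by exact: diff_coef_same.
have jo : C i != other j by rewrite /other /j; case: ifP => [/eqP->|/negbT].
have au : u <= \sum_a alpha (other j) a ^+ 2 by exact: diff_coef_other.
have lv : (u + v) / (2 * u) <= 1 + (- theta) * \sum_a alpha j a ^+ 2.
  by rewrite -tv lerD2l !mulNr lerN2 ler_pM2l.
have lu : (u + v) / (2 * v) <= 1 + theta * \sum_a alpha (other j) a ^+ 2.
  by rewrite -tu lerD2l ler_pM2l.
have bu : 0 < (u + v) / (2 * v).
  exact: (divr_gt0 (addr_gt0 u0 v0) (mulr_gt0 (ltr0Sn _ 1) v0)).
have bv : 0 < (u + v) / (2 * u).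
  exact: (divr_gt0 (addr_gt0 u0 v0) (mulr_gt0 (ltr0Sn _ 1) u0)).
(* One estimate serves both norms: [lam = - theta] for the own cluster, [lam = theta] for the other.
   Positivity of [e] ensures that the Gaussian integral formula applies. *)
have mgf_le lam (e : R) k : 0 < e -> e <= 1 + lam * \sum_a alpha k a ^+ 2 ->
  (\int[P]_w (expR (- (lam / 2 * sqnorm (fun c => x w i c - centroid C (x w) k c))))%:E
   <= ((Num.sqrt e)^-1 ^+ d)%:E)%E.
  move=> e0 el.
  under eq_integral => w _ do under eq_fun do rewrite xE.
  rewrite (integral_expR_sqnorm P _ d g (alpha k) lam hnorm hind)//; last first.
    exact: lt_le_trans el.
  rewrite lee_fin ler_pXn2r ?nnegrE ?invr_ge0 ?sqrtr_ge0//.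
  by rewrite lef_pV2 ?posrE ?sqrtr_gt0 ?ler_wsqrtr// (lt_le_trans e0).
have msq k : measurable_fun setT
    (fun w => sqnorm (fun c => x w i c - centroid C (x w) k c)).
  apply: measurable_sum => c; apply: measurable_funX.
  under eq_fun do rewrite xE.
  by apply: measurable_sum => a; exact: measurable_funM.
apply: le_trans (chernoff_diff P _ _ theta ((Num.sqrt ((u + v) / (2 * u)))^-1 ^+ d)
  ((Num.sqrt ((u + v) / (2 * v)))^-1 ^+ d) (msq _) (msq _) (ltW t0) _ _ _ _) _.
- by rewrite exprn_gt0// invr_gt0 sqrtr_gt0.
- by rewrite exprn_gt0// invr_gt0 sqrtr_gt0.
- have := mgf_le (- theta) _ j bv lv.
  by under eq_integral do rewrite !mulNr opprK.
- exact: mgf_le.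
rewrite lee_fin (rho_q_balanced n q sigma M sM M0 u0 v0) -/u -/v.
have r0 : 0 < 4 * u * v / (u + v) ^+ 2.
  exact: (divr_gt0 (mulr_gt0 (mulr_gt0 (ltr0Sn _ 3) u0) v0)
    (exprn_gt0 2 (addr_gt0 u0 v0))).
(* Both sides become nested square roots around a [d]-th power, and the innermost arguments
   agree. *)
rewrite (powR_quarter _ _ (ltW r0)) -exprMn -invfM -sqrtrM ?(ltW bv)//.
rewrite -sqrtrV ?(ltW (mulr_gt0 bv bu))//.
rewrite le_eqVlt; apply/orP; left; apply/eqP; congr (Num.sqrt (Num.sqrt _ ^+ d)).
by field; rewrite !gt_eqF// addr_gt0.
Qed.
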